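(* Let $(a_k)_{k\ge 0}$ be the Stirling coefficients, i.e. the coefficients in the asymptotic expansion $n! \sim n^n e^{-n}\sqrt{2\pi n}\,\sum_{k\ge 0} \frac{a_k}{n^k}$ as $n\to\infty$. Then for every integer $k\ge 0$, $$a_k = \frac{(2k)!}{2^k k!}\sum_{i=0}^{2k} \binom{k+i-1/2}{i}\binom{3k+1/2}{2k-i}2^{i}\sum_{j=0}^{i}\binom{i}{j}\frac{(-1)^j}{(2k+i+j)!}\sum_{l=0}^{j}(-1)^l\binom{j}{l}(j-l)^{2k+i+j}.$$
   Context: The Stirling coefficients $a_k$ are the (uniquely determined) real numbers such that, for every integer $N\ge 0$, $\frac{n!}{n^n e^{-n}\sqrt{2\pi n}} = \sum_{k=0}^{N}\frac{a_k}{n^k} + O\!\left(n^{-N-1}\right)$ as $n\to\infty$ through positive integers. For real $x$ and integer $m\ge 0$, $\binom{x}{m}=\frac{x(x-1)\cdots(x-m+1)}{m!}$ is the generalized binomial coefficient (equal to $1$ for $m=0$). The convention $0^0=1$ is used. *)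

(* Defs.v *)
From mathcomp Require Import all_boot all_order all_algebra.
From mathcomp Require Import all_classical all_reals all_analysis.

Set Implicit Arguments.
Unset Strict Implicit.
Unset Printing Implicit Defensive.

Import Order.TTheory GRing.Theory Num.Theory.
Import numFieldNormedType.Exports.

Local Open Scope classical_set_scope.
Local Open Scope ring_scope.

Definition gbinom (R : realType) (x : R) (m : nat) : R :=
  (\prod_(i < m) (x - i%:R)) / (m`!)%:R.

(* The value at n = 0 is junk; only the behavior as n tends to infinity is
   ever used. *)
Definition stirling_ratio (R : realType) (n : nat) : R :=
  (n`!)%:R / (n%:R ^+ n * expR (- n%:R) * Num.sqrt (2 * pi * n%:R)).

Definition stirling_coefficients (R : realType) (a : nat -> R) : Prop :=
  forall N : nat,
    (fun n : nat => stirling_ratio R n - \sum_(k < N.+1) a k / n%:R ^+ k : R^o)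
      =O_\oo (fun n : nat => (n%:R ^+ N.+1)^-1 : R^o).

(* Main.v *)
(* Put g = 2 (e^x - 1 - x) / x^2, G_k = g^-(k+1/2) and
     p_k(s) = (2k-1)!! [x^2k] e^(s x) G_k,
   so that heuristically (Laplace's method) Gamma(n+s) e^n n^(-n-s) sqrt(n/2pi)
   expands as sum_k p_k(s) / n^k.  No integral is needed: the relations
   g G_(k+1) = G_k and x g' = (x - 2) g + 2 give p_k' = (s - k + 1/2) p_(k-1)
   and p_k(1) = p_k(0).  Let K be the sum truncated at N.  By the differential
   equation, n^(n+s-1/2) e^-n K(n,s) is nearly constant along n + s = const, so
   moving from (n,1) to (n+1,0) shows that B(n) = sum_(k<=N) p_k(0) / n^k obeys
   the recurrence of the Stirling ratio r(n) up to a factor 1 + O(n^(-N-1)).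
   Hence rho = B/r has increments O(n^(-N-1)).  If a_j = p_j(0) for j < k then
   n^k (rho(n) - 1) tends to p_k(0) - a_k, and comparing n with 2n gives
   a_k = p_k(0) for k >= 1; a_0 = 1 is Wallis' product.  Finally p_k(0) is the
   claimed sum: its inner sums are coefficients of powers of g, and the outer
   sum interpolates g^t at t = 0, ..., 2k to t = -(k+1/2). *)

Require Import Defs.
From mathcomp Require Import all_boot all_order all_algebra.
From mathcomp Require Import all_classical all_reals all_analysis.
From mathcomp Require Import ring lra zify.

Import Order.TTheory GRing.Theory Num.Theory.
Import numFieldNormedType.Exports.

Set Implicit Arguments.
Unset Strict Implicit.
Unset Printing Implicit Defensive.

Local Open Scope classical_set_scope.
Local Open Scope ring_scope.

(** * Generalized binomial coefficients *)

Lemma gbinom0 (R : realType) (x : R) : gbinom x 0 = 1.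
Proof. by rewrite /gbinom big_ord0 fact0 divr1. Qed.

Lemma gbinomS (R : realType) (x : R) m :
  m.+1%:R * gbinom x m.+1 = (x - m%:R) * gbinom x m.
Proof.
rewrite /gbinom big_ord_recr /= factS natrM.
have h1 : m.+1%:R != 0 :> R by rewrite pnatr_eq0.
have h2 : m`!%:R != 0 :> R by rewrite pnatr_eq0 -lt0n fact_gt0.
by move: m.+1%:R m`!%:R h1 h2 => a b h1 h2; field; rewrite h1 h2.
Qed.

Lemma gbinom_mulS (R : realType) (x : R) m :
  m.+1%:R * gbinom x m.+1 = x * gbinom (x - 1) m.
Proof.
rewrite /gbinom big_ord_recl /= factS natrM subr0.
have h1 : m.+1%:R != 0 :> R by rewrite pnatr_eq0.
have h2 : m`!%:R != 0 :> R by rewrite pnatr_eq0 -lt0n fact_gt0.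
have -> : \prod_(i < m) (x - (bump 0 i)%:R) = \prod_(i < m) (x - 1 - i%:R).
  by apply: eq_bigr => i _; rewrite /bump /= natrD opprD addrA.
by move: m.+1%:R m`!%:R h1 h2 => a b h1 h2; field; rewrite h1 h2.
Qed.

Lemma gbinom_pascal (R : realType) (x : R) m :
  gbinom (x + 1) m.+1 = gbinom x m.+1 + gbinom x m.
Proof.
have h1 : m.+1%:R != 0 :> R by rewrite pnatr_eq0.
apply: (mulfI h1); rewrite gbinom_mulS addrK mulrDr gbinomS -natr1; ring.
Qed.

Lemma gbinom_Vandermonde (R : realType) (x y : R) n :
  gbinom (x + y) n = \sum_(i < n.+1) gbinom x i * gbinom y (n - i).
Proof.
elim: n => [|n IH]; first by rewrite big_ord1 !gbinom0 mulr1.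
have h1 : n.+1%:R != 0 :> R by rewrite pnatr_eq0.
apply: (mulfI h1); rewrite gbinomS IH !mulr_sumr.
have -> : \sum_(i < n.+2) n.+1%:R * (gbinom x i * gbinom y (n.+1 - i)) =
  \sum_(i < n.+2) (i%:R * gbinom x i) * gbinom y (n.+1 - i) +
  \sum_(i < n.+2) gbinom x i * ((n.+1 - i)%:R * gbinom y (n.+1 - i)).
  rewrite -big_split /=; apply: eq_bigr => i _.
  by rewrite natrB ?[(i <= _)%N]ltn_ord //; [ring | rewrite -ltnS ltn_ord].
rewrite [X in _ = X + _]big_ord_recl [X in _ = _ + X]big_ord_recr /= subnn !mul0r mulr0.
rewrite add0r addr0 -big_split; apply: eq_bigr => i _ /=.
rewrite /bump /= add1n subSS gbinomS subSn; last by rewrite -ltnS ltn_ord.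
rewrite gbinomS natrB; last by rewrite -ltnS ltn_ord.
ring.
Qed.

Lemma gbinom_mul_bin (R : realType) (x : R) m i :
  gbinom x (m + i) * 'C(m + i, m)%:R = gbinom x m * gbinom (x - m%:R) i.
Proof.
rewrite /gbinom big_split_ord /=.
have -> : \prod_(j < i) (x - (m + j)%:R) = \prod_(j < i) (x - m%:R - j%:R).
  by apply: eq_bigr => j _; rewrite natrD; ring.
have /(congr1 (fun k => k%:R : R)) := @bin_fact (m + i) m (leq_addr _ _).
rewrite addKn !natrM => <-.
have h1 : m`!%:R != 0 :> R by rewrite pnatr_eq0 -lt0n fact_gt0.
have h2 : i`!%:R != 0 :> R by rewrite pnatr_eq0 -lt0n fact_gt0.
have h3 : 'C(m + i, m)%:R != 0 :> R by rewrite pnatr_eq0 -lt0n bin_gt0 leq_addr.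
by field; rewrite h1 h2 h3.
Qed.

(** Upper negation, by reversing the order of the factors. It brings the first binomial of the
    formula to the upper argument -(k+1/2). *)
Lemma gbinom_opp (R : realType) (x : R) i :
  gbinom (x + i%:R - 1) i = (-1) ^+ i * gbinom (- x) i.
Proof.
rewrite /gbinom mulrA; congr (_ / _).
rewrite -[in (-1) ^+ i](card_ord i) -prodr_const -big_split /=.
rewrite (reindex_inj rev_ord_inj) /=; apply: eq_bigr => j _.
by rewrite natrB // -natr1; ring.
Qed.

Lemma gbinom_nat (R : realType) n : gbinom (n%:R : R) n = 1.
Proof.
elim: n => [|n IH]; first exact: gbinom0.
have h1 : n.+1%:R != 0 :> R by rewrite pnatr_eq0.
by apply: (mulfI h1); rewrite gbinom_mulS -[X in gbinom (X - 1)]natr1 addrK IH.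
Qed.

(* Evaluates at [1 + z] the Lagrange interpolation of [t |-> z ^ t] at the
   nodes 0, ..., M: to order M it is the binomial series of [(1 + z) ^ x]. *)
Lemma binomial_interpolation (R : realType) (x : R) M (z : {poly R}) :
  \sum_(i < M.+1) (gbinom x i * gbinom (M%:R - x) (M - i)) *: (1 + z) ^+ i =
  \sum_(m < M.+1) gbinom x m *: z ^+ m.
Proof.
have pow1D (i : 'I_M.+1) : (1 + z) ^+ i = \sum_(m < M.+1) z ^+ m *+ 'C(i, m).
  rewrite exprDn (big_ord_widen M.+1 (fun m => 1 ^+ (i - m) * z ^+ m *+ 'C(i, m))).
    rewrite big_mkcond; apply: eq_bigr => m _; rewrite expr1n mul1r.
    by case: ltnP => // ?; rewrite bin_small ?mulr0n.
  by rewrite ltn_ord.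
under eq_bigr => i _ do rewrite pow1D scaler_sumr.
rewrite exchange_big /=; apply: eq_bigr => m _.
under eq_bigr => i _ do rewrite -scalerMnr scalerMnl -mulr_natr.
rewrite -scaler_suml; congr (_ *: _).
have [r Mmr] : exists r, M = (m + r)%N.
  by exists (M - m)%N; rewrite subnKC // -ltnS ltn_ord.
move: m => [m ltmM] /= in Mmr *; subst M.
rewrite -(big_mkord xpredT (fun i => gbinom x i *
  gbinom ((m + r)%:R - x) (m + r - i) * 'C(i, m)%:R)).
rewrite -addnS big_mkord big_split_ord /= big1 ?add0r; last first.
  by move=> i _; rewrite (@bin_small i) ?mulr0.
under eq_bigr => i _.
  rewrite subnDl mulrAC gbinom_mul_bin -mulrA.
  over.
(* The two upper arguments add up to r = M - m, so the Vandermonde sum is binom(r, r) = 1. *)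
rewrite -mulr_sumr -gbinom_Vandermonde.
have -> : x - m%:R + ((m + r)%:R - x) = r%:R by rewrite natrD; ring.
by rewrite gbinom_nat mulr1.
Qed.

(** * Powers of 2 (e^X - 1 - X) / X^2 *)

(** The binomial series of (1 + y)^x cut after y^n. For y divisible by X the omitted terms are
    multiples of X^(n+1); the identities below keep such terms as explicit remainders. *)
Definition binser (R : realType) n (x : R) (y : {poly R}) : {poly R} :=
  \sum_(m < n.+1) gbinom x m *: y ^+ m.

Lemma binser_mul (R : realType) n (x : R) (y : {poly R}) :
  binser n x y * (1 + y) = binser n (x + 1) y + gbinom x n *: y ^+ n.+1.
Proof.
rewrite /binser; elim: n => [|n IH].
  by rewrite !big_ord1 !gbinom0 !expr0 expr1 !scale1r mul1r.
rewrite big_ord_recr /= mulrDl IH [in RHS]big_ord_recr /= gbinom_pascal.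
rewrite mulrDr mulr1 -scalerAl -exprSr scalerDl.
by rewrite -!addrA; congr (_ + _); rewrite addrCA.
Qed.

Lemma deriv_binser (R : realType) n (x : R) (y : {poly R}) :
  (binser n (x + 1) y)^`() =
  (x + 1) *: (y^`() * (binser n x y - gbinom x n *: y ^+ n)).
Proof.
rewrite /binser linear_sum /= big_ord_recl expr0 derivZ derivC scaler0 add0r.
rewrite big_ord_recr /= addrK mulr_sumr scaler_sumr; apply: eq_bigr => i _.
rewrite derivZ deriv_exp /bump /= add1n -scalerMnr scalerMnl -mulr_natl.
by rewrite gbinom_mulS addrK -scalerA scalerAr.
Qed.

Section Series.
Variables (R : realType) (n : nat).

(* The truncation of [2 (e^X - 1 - X) / X^2]. *)
Definition phiser : {poly R} := \poly_(i < n.+1) (2 / (i.+2)`!%:R).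

Lemma phiser_subr1 : exists w, phiser = 1 + 'X * w.
Proof.
exists (\poly_(i < n) (2 / (i.+3)`!%:R)); apply/polyP => i.
rewrite coefD coefXM !coef_poly coef1; case: i => [|i] /=.
  by rewrite addr0 divff // pnatr_eq0.
by rewrite add0r.
Qed.

(** Truncates x g' = (x - 2) g + 2; the term with [c] cancels the coefficient of X^(n+1) in
    ['X * phiser]. *)
Lemma deriv_phiser : exists c,
  'X * phiser^`() = 'X * phiser + 2%:P - 2%:P * phiser + c *: 'X^(n.+1).
Proof.
exists (- (2 / (n.+2)`!%:R)); apply/polyP => i.
rewrite !coefD coefN !coefXM coefCM coefC coefZ coefXn coef_deriv !coef_poly.
have fne j : j`!%:R != 0 :> R by rewrite pnatr_eq0 -lt0n fact_gt0.
case: i => [|i] /=; first by rewrite mulr0 addr0 divff ?mulr1 ?fne//; ring.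
rewrite eqSS !ltnS; case: (ltngtP i n) => [_|_|->] /=.
- have i1E : i.+1%:R = i.+3%:R - 2 :> R by rewrite -[i.+3]addn2 natrD addrK.
  have i3ne0 : i.+3%:R != 0 :> R by rewrite pnatr_eq0.
  rewrite -[X in X = _]mulr_natr [(i.+3)`!]factS natrM i1E.
  move: i.+3%:R (i.+2)`!%:R i3ne0 (fne i.+2) => a b a0 b0.
  by field; rewrite fne a0 b0.
- by rewrite mul0rn !(mulr0, addr0, subr0).
- by rewrite mul0rn; move: (2 / _) => a; ring.
Qed.

End Series.

Definition phipow (R : realType) n (x : R) : {poly R} := binser n x (phiser R n - 1).

Lemma phipow_mul (R : realType) n (x : R) : exists q,
  phipow n x * phiser R n = phipow n (x + 1) + 'X^(n.+1) * q.
Proof.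
have [w phiE] := phiser_subr1 R n.
exists (gbinom x n *: w ^+ n.+1).
have wE : phiser R n - 1 = 'X * w by rewrite phiE addrC addKr.
rewrite /phipow wE -[phiser R n](addrNK 1) wE [_ + 1]addrC binser_mul.
by rewrite exprMn scalerAr.
Qed.

Lemma deriv_phipow (R : realType) n (x : R) : exists q,
  'X * (phipow n (x + 1))^`() = (x + 1) *: ('X * phipow n (x + 1) +
     2%:P * phipow n x - 2%:P * phipow n (x + 1)) + 'X^(n.+1) * q.
Proof.
have [w phiE] := phiser_subr1 R n.
have [c dphiE] := deriv_phiser R n.
have [q GE] := phipow_mul n x.
have wE : phiser R n - 1 = 'X * w by rewrite phiE addrC addKr.
set G := phipow n x in GE *; set H := phipow n (x + 1) in GE *.
exists ((x + 1) *: ('X * q - 2%:P * q + c *: G -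
  (phiser R n)^`() * ((gbinom x n)%:P * w ^+ n))).
rewrite [in LHS]/H /phipow deriv_binser derivB derivC subr0 -/(phipow n x) -/G.
rewrite wE exprMn -!mul_polyC.
have -> : 'X * ((x + 1)%:P * ((phiser R n)^`() * (G - (gbinom x n)%:P * ('X^n * w ^+ n)))) =
  (x + 1)%:P * (('X * (phiser R n)^`()) * G
     - 'X^(n.+1) * ((phiser R n)^`() * ((gbinom x n)%:P * w ^+ n))).
  by rewrite exprS; ring.
rewrite dphiE -mul_polyC.
have -> : ('X * phiser R n + 2%:P - 2%:P * phiser R n + c%:P * 'X^(n.+1)) * G =
  'X * (G * phiser R n) + 2%:P * G - 2%:P * (G * phiser R n) + c%:P * 'X^(n.+1) * G by ring.
rewrite GE; ring.
Qed.

(** Compares coefficients of X^(m+1) in [deriv_phipow]; as m < n, the remainder does not reach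
    them. *)
Lemma coef_phipow_rec (R : realType) n (x : R) m : (m < n)%N ->
  - 2 * (x + 1) * (phipow n x)`_m.+1 = (x + 1) * (phipow n (x + 1))`_m
   - (2 * (x + 1) + m.+1%:R) * (phipow n (x + 1))`_m.+1.
Proof.
move=> ltmn; have [q /(congr1 (fun p : {poly R} => p`_m.+1))] := deriv_phipow n x.
rewrite coefXM /= coef_deriv coefD coefXnM ltnS ltmn addr0 coefZ !coefB !coefD.
rewrite coefXM !coefCM /= -[_ *+ m.+1]mulr_natr.
move: (_)`_m (_)`_m.+1 (_)`_m.+1 (m.+1%:R) => a b c d cdE.
by rewrite [(_ + d) * c]mulrDl [d * c]mulrC cdE; ring.
Qed.

(** * Coefficients of powers of e^X - 1 and of g *)

Section TruncatedExponential.
Variables (R : realType) (M : nat).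

Definition expser : {poly R} := \poly_(i < M) (i`!%:R)^-1.

Lemma coef_expser_exp a m : (m < M)%N ->
  (expser ^+ a)`_m = a%:R ^+ m / m`!%:R.
Proof.
elim: a m => [|a IH] m ltmM.
  rewrite expr0 coef1; case: m {ltmM} => [|m] /=; first by rewrite expr0 fact0 divr1.
  by rewrite expr0n mul0r.
rewrite exprSr coefMr -natr1 exprDn mulr_suml; apply: eq_bigr => i _.
have leim : (i <= m)%N by rewrite -ltnS.
rewrite expr1n mulr1 IH ?coef_poly ?(leq_ltn_trans leim) ?(leq_ltn_trans (leq_subr _ _)) //.
rewrite -[_ *+ 'C(m, i)]mulr_natr -(bin_fact leim) !natrM.
have h1 : i`!%:R != 0 :> R by rewrite pnatr_eq0 -lt0n fact_gt0.
have h2 : (m - i)`!%:R != 0 :> R by rewrite pnatr_eq0 -lt0n fact_gt0.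
have h3 : 'C(m, i)%:R != 0 :> R by rewrite pnatr_eq0 -lt0n bin_gt0.
move: i`!%:R (m - i)`!%:R 'C(m, i)%:R h1 h2 h3 (_ ^+ (m - i)) => b c d h1 h2 h3 e.
by field; rewrite h1 h2 h3.
Qed.

(** The binomial theorem leaves powers e^((j-l)X), whence the innermost sum of the formula. *)
Lemma coef_expser_subr1_exp j m : (m < M)%N ->
  ((expser - 1) ^+ j)`_m =
  (\sum_(l < j.+1) (-1) ^+ l * 'C(j, l)%:R * (j%:R - l%:R) ^+ m) / m`!%:R.
Proof.
move=> ltmM; rewrite exprDn coef_sum mulr_suml; apply: eq_bigr => l _.
rewrite -(natrB _ (ltn_ord l : (l <= j)%N)) coefMn -polyCN -polyC_exp coefMC.
rewrite coef_expser_exp // -[_ *+ _]mulr_natr.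
by move: (m`!%:R^-1) (_ ^+ m) => b c; ring.
Qed.

End TruncatedExponential.

Lemma expser_phiser (R : realType) n :
  expser R n.+3 - 1 = 'X * (1 + 'X * 2^-1%:P * phiser R n).
Proof.
apply/polyP => i; rewrite coefB coef1 coefXM coef_poly.
case: i => [|i] /=; first by rewrite fact0 invr1 subrr.
rewrite coefD coef1 -mulrA coefXM coefCM coef_poly.
case: i => [|i] /=; first by rewrite invr1 subr0 addr0.
rewrite !ltnS subr0 add0r; case: ifP => _; last by rewrite mulr0.
by rewrite mulrA mulVf ?mul1r ?pnatr_eq0.
Qed.

(** With h = (e^x - 1)/x = 1 + x g/2, the sum over j is the coefficient of x^(2k+i) in (1 - h)^i =
    (-x g/2)^i. The hypothesis covers the largest index 2k+i+j, at j = i. *)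
Lemma coef_phiser_exp (R : realType) n k i : (2 * k + i + i < n.+3)%N ->
  2 ^+ i * \sum_(j < i.+1)
    'C(i, j)%:R * ((-1) ^+ j / ((2 * k + i + j)`!)%:R) *
    \sum_(l < j.+1)
       (-1) ^+ l * 'C(j, l)%:R * (j%:R - l%:R) ^+ (2 * k + i + j) =
  (-1) ^+ i * (phiser R n ^+ i)`_(2 * k).
Proof.
move=> lt_n; set h := 1 + 'X * 2^-1%:P * phiser R n.
have step (j : 'I_i.+1) :
    'C(i, j)%:R * ((-1) ^+ j / ((2 * k + i + j)`!)%:R) *
    \sum_(l < j.+1)
       (-1) ^+ l * 'C(j, l)%:R * (j%:R - l%:R) ^+ (2 * k + i + j) =
    ((- h) ^+ j *+ 'C(i, j))`_(2 * k + i).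
  have -> : (- h) ^+ j = (-1) ^+ j *: h ^+ j by rewrite -scaleN1r exprZn.
  rewrite coefMn coefZ.
  have -> : (h ^+ j)`_(2 * k + i) = ((expser R n.+3 - 1) ^+ j)`_(2 * k + i + j).
    by rewrite expser_phiser exprMn coefXnM ltnNge leq_addl addnK.
  rewrite coef_expser_subr1_exp; last first.
    by rewrite (leq_ltn_trans _ lt_n) // leq_add2l -ltnS.
  by rewrite -[_ *+ 'C(i, j)]mulr_natr; move: (\sum_(l < _) _) (_`!%:R^-1) => s t; ring.
under eq_bigr => j _ do rewrite step.
rewrite -coef_sum.
have -> : \sum_(j < i.+1) (- h) ^+ j *+ 'C(i, j) = (1 - h) ^+ i.
  by rewrite exprDn; apply: eq_bigr => j _; rewrite expr1n mul1r.
have -> : 1 - h = (- 2^-1) *: ('X * phiser R n).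
  by rewrite /h -mul_polyC polyCN; ring.
rewrite exprZn coefZ exprMn coefXnM ltnNge leq_addl addnK mulrA.
by rewrite -exprMn mulrN divff ?pnatr_eq0.
Qed.

Lemma coef_phiser_subr1_exp (R : realType) n m r : (r < m)%N ->
  ((phiser R n - 1) ^+ m)`_r = 0.
Proof.
have [w ->] := phiser_subr1 R n.
by move=> ltrm; rewrite addrC addKr exprMn coefXnM ltrm.
Qed.

(** As [phiser - 1] is divisible by X, only its powers up to r reach degree r. Cutting the series
    there gives the form required by [binomial_interpolation]. *)
Lemma coef_phipow (R : realType) n (x : R) r : (r <= n)%N ->
  (phipow n x)`_r = (\sum_(m < r.+1) gbinom x m *: (phiser R n - 1) ^+ m)`_r.
Proof.
move=> lern; rewrite /phipow /binser !coef_sum.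
rewrite [RHS](big_ord_widen n.+1
  (fun m => (gbinom x m *: (phiser R n - 1) ^+ m)`_r)) ?ltnS //.
rewrite big_mkcond [in RHS]big_mkcond; apply: eq_bigr => m _.
rewrite coefZ; case: ltnP => // ltrm.
by rewrite coef_phiser_subr1_exp ?mulr0.
Qed.

Lemma coef0_phipow (R : realType) n (x : R) : (phipow n x)`_0 = 1.
Proof.
by rewrite coef_phipow // big_ord1 gbinom0 scale1r expr0 coef1.
Qed.

Definition stirling_formula (R : realType) k : R :=
  ((2 * k)`!)%:R / (2 ^+ k * (k`!)%:R) *
    \sum_(i < (2 * k).+1)
      gbinom (k%:R + i%:R - 1 / 2) i * gbinom (3 * k%:R + 1 / 2) (2 * k - i)
        * 2 ^+ i *
      \sum_(j < i.+1)
        'C(i, j)%:R * ((-1) ^+ j / ((2 * k + i + j)`!)%:R) *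
        \sum_(l < j.+1)
          (-1) ^+ l * 'C(j, l)%:R * (j%:R - l%:R) ^+ (2 * k + i + j).

(* This is the Gaussian moment (2k-1)!!. *)
Definition dfact (R : realType) k : R := ((2 * k)`!)%:R / (2 ^+ k * (k`!)%:R).

Lemma dfactS (R : realType) k : dfact R k.+1 = (2 * k%:R + 1) * dfact R k.
Proof.
rewrite /dfact mulnS !add2n 3!factS !natrM exprS.
have h1 : k`!%:R != 0 :> R by rewrite pnatr_eq0 -lt0n fact_gt0.
have h2 : k.+1%:R != 0 :> R by rewrite pnatr_eq0.
have h3 : 2 ^+ k != 0 :> R by rewrite expf_neq0 // pnatr_eq0.
have -> : (2 * k).+2%:R = 2 * k.+1%:R :> R by rewrite -natrM mulnS.
have -> : (2 * k).+1%:R = 2 * k%:R + 1 :> R by rewrite -natr1 natrM.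
move: k`!%:R k.+1%:R (2 * k)`!%:R (2 ^+ k) h1 h2 h3 => a b c d h1 h2 h3.
by field; rewrite h1 h2 h3.
Qed.

(** * The polynomials p_k *)

Section Moments.
Variables (R : realType) (n : nat).

Let c k m : R := (phipow n (- (k%:R + 1 / 2)))`_m.

(** Interpolation at x = -(k+1/2) with M = 2k, so that M - x = 3k+1/2; the signs from [gbinom_opp]
    and [coef_phiser_exp] cancel. The bound 6k is the value of 2k+2i at i = 2k. *)
Lemma stirling_formulaE k : (6 * k <= n)%N ->
  stirling_formula R k = dfact R k * c k (2 * k).
Proof.
move=> lekn; rewrite /stirling_formula -/(dfact R k); congr (_ * _).
rewrite /c coef_phipow; last by lia.
rewrite -binomial_interpolation coef_sum; apply: eq_bigr => i _.
have ltik := ltn_ord i.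
rewrite -mulrA (@coef_phiser_exp _ n); last by lia.
rewrite [1 + _]addrC addrNK coefZ.
have -> : k%:R + i%:R - 1 / 2 = (k%:R + 1 / 2) + i%:R - 1 :> R by field.
have -> : 3 * k%:R + 1 / 2 = (2 * k)%:R - - (k%:R + 1 / 2) :> R.
  by rewrite natrM; ring.
have sgn2 : (-1) ^+ i * (-1) ^+ i = 1 :> R by rewrite -expr2 sqrr_sign.
rewrite gbinom_opp; move: (gbinom _ _) (gbinom _ i) (phiser R n ^+ i)`_(2 * k) => u v w.
by move: ((-1) ^+ i) sgn2 => s sgn2; rewrite -[RHS]mul1r -sgn2; ring.
Qed.

(** The case x = -(k+3/2) of [coef_phipow_rec]. At m = 2k the first term on the right vanishes,
    which [deriv_moment] and [moment_at1] both exploit. *)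
Lemma coef_phipow_half_rec k m : (m < n)%N ->
  (2 * k%:R + 1) * c k.+1 m.+1 =
  (2 * k%:R - m%:R) * c k m.+1 - (k%:R + 1 / 2) * c k m.
Proof.
move=> ltmn; rewrite /c.
have := coef_phipow_rec (- (k.+1%:R + 1 / 2) : R) ltmn.
have -> : - (k.+1%:R + 1 / 2) + 1 = - (k%:R + 1 / 2) :> R by rewrite -natr1; ring.
move: (_)`_m.+1 (_)`_m (_)`_m.+1 => u v w.
rewrite -[m.+1%:R]natr1; lra.
Qed.

(** This is p_k(s): the factor e^(s x) contributes s^j/j! at x^j and leaves [x^(2k-j)] G_k. *)
Definition moment k : {poly R} :=
  \poly_(j < (2 * k).+1) (dfact R k * c k (2 * k - j) / j`!%:R).

Lemma moment0 : moment 0 = 1.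
Proof.
apply/polyP => i; rewrite coef_poly coef1 muln0 ltnS.
case: i => [|i] //=.
by rewrite /dfact /c muln0 coef0_phipow !fact0 expr0 !mulr1 !divr1.
Qed.

Lemma moment_at0 k : (moment k).[0] = dfact R k * c k (2 * k).
Proof. by rewrite horner_coef0 coef_poly /= subn0 fact0 divr1. Qed.

Lemma deriv_moment k : (2 * k < n)%N ->
  (moment k.+1)^`() = ('X - (k%:R + 1 / 2)%:P) * moment k.
Proof.
move=> ltkn; apply/polyP => j.
rewrite coef_deriv mulrBl coefB coefXM coefCM !coef_poly.
have fne i : i`!%:R != 0 :> R by rewrite pnatr_eq0 -lt0n fact_gt0.
have -> : (j.+1 < (2 * k.+1).+1)%N = (j <= (2 * k).+1)%N by lia.
rewrite dfactS.
case: j => [|j] /=.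
  have -> : (2 * k.+1 - 1 = (2 * k).+1)%N by lia.
  have := coef_phipow_half_rec k ltkn; rewrite natrM subrr mul0r.
  rewrite subn0 factS fact0 mulr1n !divr1.
  move: (c k.+1 _) (c k _) (dfact R k) => u v d e.
  by rewrite mulrAC e; ring.
have -> : (2 * k.+1 - j.+2 = 2 * k - j)%N by lia.
rewrite !ltnS; case: (ltngtP j (2 * k)) => [ltjk|_|->]; last first.
- rewrite subnn mulr0 subr0 {1}/c {1}/c !coef0_phipow [(_.+2)`!]factS [(_.+1)`!]factS.
  rewrite -[_ *+ (2 * k).+2]mulr_natr !natrM -[(2 * k).+1%:R]natr1 natrM.
  have h : (2 * k).+2%:R != 0 :> R by rewrite pnatr_eq0.
  have h' : 2 * k%:R + 1 != 0 :> R by rewrite -natrM natr1 pnatr_eq0.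
  move: (2 * k).+2%:R (2 * k)`!%:R (2 * k%:R + 1) (fne (2 * k)%N) (dfact R k) h h'.
  by move=> a b e b0 d a0 e0; field; rewrite a0 b0 e0.
- by rewrite mul0rn mulr0 subr0.
(* The case j < 2k is the recurrence at m = 2k-j-1, whose factor 2k-m = j+1 turns 1/(j+1)! into
   1/j!. *)
have ltmn : ((2 * k - j.+1) < n)%N by lia.
have := coef_phipow_half_rec k ltmn.
rewrite (_ : (2 * k - j.+1).+1 = 2 * k - j)%N; last by lia.
have -> : 2 * k%:R - (2 * k - j.+1)%:R = j.+1%:R :> R by rewrite natrB // natrM; ring.
rewrite [(j.+2)`!]factS -[_ *+ j.+2]mulr_natr natrM.
have h : j.+2%:R != 0 :> R by rewrite pnatr_eq0.
move: (c k.+1 _) => u E.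
have -> : (2 * k%:R + 1) * dfact R k * u / (j.+2%:R * (j.+1)`!%:R) * j.+2%:R =
   dfact R k * ((2 * k%:R + 1) * u) / (j.+1)`!%:R.
  by move: j.+2%:R (j.+1)`!%:R h (fne j.+1) => a b a0 b0; field; rewrite a0 b0.
rewrite E factS natrM.
have h' : j.+1%:R != 0 :> R by rewrite pnatr_eq0.
move: j.+1%:R j`!%:R h' (fne j) (c k _) (c k _) => a b a0 b0 v w.
by field; rewrite a0 b0.
Qed.

(** For k > 0, p_k(1) - p_k(0) is (2k-1)!! times [x^2k] (e^x - 1) G_k. Since e^x - 1 = x + x^2 g/2,
    this coefficient is [x^(2k-1)] G_k + [x^(2k-2)] G_(k-1) / 2, which the recurrence makes zero. *)
Lemma moment_at1 k : (2 * k <= n)%N -> (moment k).[1] = (moment k).[0].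
Proof.
case: k => [|k] lekn; first by rewrite moment0 !hornerE.
set G := phipow n (- (k.+1%:R + 1 / 2) : R).
have ltkn : (2 * k < n)%N by lia.
have eG : ((expser R n.+3 - 1) * G)`_(2 * k.+1) = 0.
  have -> : (2 * k.+1 = (2 * k).+2)%N by lia.
  rewrite expser_phiser -['X * _ * G]mulrA coefXM /= mulrDl mul1r coefD.
  rewrite -!mulrA coefXM /= coefCM [phiser R n * G]mulrC.
  have [q] := phipow_mul n (- (k.+1%:R + 1 / 2) : R); rewrite -/G => ->.
  rewrite coefD coefXnM ltnS (ltnW ltkn) addr0.
  have -> : - (k.+1%:R + 1 / 2) + 1 = - (k%:R + 1 / 2) :> R by rewrite -natr1; ring.
  rewrite -/(c k (2 * k)) -/(c k.+1 (2 * k).+1).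
  have := coef_phipow_half_rec k ltkn; rewrite natrM subrr mul0r.
  move: (c k.+1 _) (c k _) => u v e.
  have h' : 2 * k%:R + 1 != 0 :> R by rewrite -natrM natr1 pnatr_eq0.
  by apply: (mulfI h'); rewrite mulrDr e; field.
rewrite moment_at0 /moment horner_poly big_ord_recl /= subn0 fact0 expr0 mulr1 divr1.
rewrite -[RHS]addr0; congr (_ + _).
move: eG; rewrite coefM big_ord_recl /= !coefB coef1 coef_poly /= fact0 invr1 subrr mul0r add0r.
move=> eG; rewrite -[RHS](mulr0 (dfact R k.+1)) -[in RHS]eG mulr_sumr.
apply: eq_bigr => j _; rewrite coefB coef1 coef_poly /= subr0 expr1n mulr1.
rewrite (_ : (bump 0 j < n.+3)%N = true) ?/c; last by have := ltn_ord j; rewrite /bump; lia.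
by rewrite -/G -mulrA [in LHS](mulrC _ (_^-1)).
Qed.

End Moments.

Lemma moment_system (R : realType) N : exists p : nat -> {poly R},
  [/\ p 0 = 1,
      forall k, (k < N)%N -> (p k.+1)^`() = ('X - (k%:R + 1 / 2)%:P) * p k,
      forall k, (k <= N)%N -> (p k).[1] = (p k).[0]
    & forall k, (k <= N)%N -> (p k).[0] = stirling_formula R k].
Proof.
exists (moment R (6 * N)); split=> [|k lekN|k lekN|k lekN].
- exact: moment0.
- by apply: deriv_moment; lia.
- by apply: moment_at1; lia.
- by rewrite moment_at0 (@stirling_formulaE R (6 * N)) //; lia.
Qed.

(** * Wallis' product *)

Lemma MVT_cc (R : realType) (f df : R -> R) (a b : R) : a <= b ->
  (forall x, a <= x <= b -> is_derive x 1 f (df x)) ->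
  exists2 c, a <= c <= b & f b - f a = df c * (b - a).
Proof.
move=> ab fdf.
have [c||c cab cE] := @MVT_segment R f df a b ab.
- by rewrite in_itv /= => /andP[ac cb]; apply: fdf; rewrite !ltW.
- apply: derivable_within_continuous => x; rewrite in_itv /= => /fdf h.
  exact: ex_derive.
by exists c => //; move: cab; rewrite in_itv.
Qed.

(** The antiderivative of cos^n vanishing at 0, built by the reduction formula, so that Wallis'
    integrals are values of it. *)
Fixpoint cosprim (R : realType) n (x : R) : R :=
  match n with
  | 0%N => x
  | 1%N => sin x
  | (m.+1 as m1).+1 => (cos x ^+ m1 * sin x + m1%:R * cosprim m x) / m1.+1%:R
  end.

Lemma nat_ind2 (P : nat -> Prop) :
  P 0%N -> P 1%N -> (forall n, P n -> P n.+2) -> forall n, P n.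
Proof.
move=> P0 P1 PS n; suff [] : P n /\ P n.+1 by [].
by elim: n => [//|n [Pn PSn]]; split=> //; apply: PS.
Qed.

Lemma is_derive_cosprim (R : realType) n (x : R) :
  is_derive x 1 (cosprim n) (cos x ^+ n).
Proof.
elim/nat_ind2: n => [||n IH].
- by rewrite expr0; exact: is_derive_id.
- by rewrite expr1; exact: is_derive_sin.
have -> : cosprim n.+2 = n.+2%:R^-1 \*: (cos ^+ n.+1 * sin + n.+1%:R \*: cosprim n) :> (R -> R).
  by apply/funext => y; rewrite [LHS]/= mulrC !fctE.
apply: is_derive_eq.
have h : n.+2%:R != 0 :> R by rewrite pnatr_eq0.
rewrite /GRing.scale /= fctE; apply: (mulfI h); rewrite mulVKf // -[n.+2%:R]natr1.
have sE : sin x * sin x = 1 - cos x * cos x.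
  by rewrite -(cos2Dsin2 x) -!expr2 addrC addKr.
rewrite !exprS; move: (cos x ^+ n) n.+1%:R => u v.
have -> : sin x * (v * u * - sin x) = - (v * u * (sin x * sin x)) by ring.
by rewrite sE; ring.
Qed.

Lemma cosprim0 (R : realType) n : cosprim n (0 : R) = 0.
Proof.
elim/nat_ind2: n => [||n IH] //=; first exact: sin0.
by rewrite sin0 IH !mulr0 addr0 mul0r.
Qed.

Definition wallis (R : realType) n : R := cosprim n (pi / 2).

Lemma wallisSS (R : realType) n : wallis R n.+2 = n.+1%:R / n.+2%:R * wallis R n.
Proof.
by rewrite /wallis /= cos_pihalf expr0n /= mul0r add0r mulrAC.
Qed.

Lemma wallis_mulS (R : realType) n : n.+1%:R * (wallis R n * wallis R n.+1) = pi / 2.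
Proof.
elim: n => [|n IH].
  by rewrite /wallis /= sin_pihalf mul1r mulr1.
rewrite wallisSS -IH.
have h : n.+2%:R != 0 :> R by rewrite pnatr_eq0.
by move: n.+2%:R h => a a0; field.
Qed.

(** The mean value theorem carries 0 <= cos^(n+1) <= cos^n on [0, pi/2] over to the integrals. *)
Lemma wallis_decr (R : realType) n : 0 <= wallis R n.+1 <= wallis R n.
Proof.
have pihalf0 : 0 <= pi / 2 :> R by rewrite divr_ge0 // pi_ge0.
have cos01 (x : R) : 0 <= x <= pi / 2 -> 0 <= cos x <= 1.
  move=> /andP[x0 x1]; rewrite cos_le1 andbT cos_ge0_pihalf // x1 andbT.
  by rewrite (le_trans _ x0) // oppr_le0.
apply/andP; split.
  have [c /cos01 /andP[c0 _]] := MVT_cc pihalf0 (fun x _ => is_derive_cosprim n.+1 x).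
  rewrite cosprim0 !subr0 -/(wallis R n.+1) => ->.
  by rewrite mulr_ge0 // exprn_ge0.
have dB (x : R) : 0 <= x <= pi / 2 ->
    is_derive x 1 (cosprim n - cosprim n.+1 : R -> R) (cos x ^+ n - cos x ^+ n.+1).
  by move=> _; apply: is_deriveB; exact: is_derive_cosprim.
have [c /cos01 /andP[c0 c1]] := MVT_cc pihalf0 dB.
rewrite !fctE !cosprim0 !subr0 -/(wallis R n) -/(wallis R n.+1) => E.
rewrite -subr_ge0 E mulr_ge0 // exprSr -{1}[_ ^+ n]mulr1 -mulrBr.
by rewrite mulr_ge0 ?exprn_ge0 ?subr_ge0.
Qed.

Lemma wallis_even (R : realType) n :
  wallis R (2 * n) = pi / 2 * ((2 * n)`!%:R / (4 ^+ n * n`!%:R ^+ 2)).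
Proof.
elim: n => [|n IH].
  by rewrite muln0 fact0 expr0 expr1n mul1r divr1 mulr1.
have -> : (2 * n.+1 = (2 * n).+2)%N by lia.
rewrite wallisSS IH 3!factS !natrM [4 ^+ n.+1]exprS.
have -> : (2 * n).+2%:R = 2 * n.+1%:R :> R by rewrite -natrM; congr (_%:R); lia.
have h1 : n`!%:R != 0 :> R by rewrite pnatr_eq0 -lt0n fact_gt0.
have h2 : n.+1%:R != 0 :> R by rewrite pnatr_eq0.
have h3 : 4 ^+ n != 0 :> R by rewrite expf_neq0 // pnatr_eq0.
move: n`!%:R n.+1%:R (2 * n)`!%:R (2 * n).+1%:R (4 ^+ n) h1 h2 h3 => a b c d e h1 h2 h3.
by field; rewrite h1 h2 h3.
Qed.

(** * The Stirling ratio *)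

Section StirlingRatio.
Variable R : realType.

Definition stirling_scale (n : nat) : R :=
  Num.sqrt (2 * pi) * expR ((n%:R + 1 / 2) * ln n%:R - n%:R).

Lemma stirling_scale_gt0 n : 0 < stirling_scale n.
Proof. by rewrite mulr_gt0 ?expR_gt0 // sqrtr_gt0 mulr_gt0 // pi_gt0. Qed.

Lemma stirling_ratioE n : (0 < n)%N ->
  stirling_ratio R n = n`!%:R / stirling_scale n.
Proof.
move=> n0; have n0' : 0 < n%:R :> R by rewrite ltr0n.
rewrite /stirling_ratio /stirling_scale; congr (_ / _).
rewrite sqrtrM; last by rewrite mulr_ge0 ?pi_ge0.
have -> : n%:R ^+ n = expR (n%:R * ln n%:R) :> R.
  by rewrite mulrC expRM_natr lnK // posrE.
have -> : Num.sqrt n%:R = expR (1 / 2 * ln n%:R) :> R.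
  rewrite -[in LHS](lnK (n0' : n%:R \is Num.pos)).
  have -> : ln n%:R = 1 / 2 * ln n%:R + 1 / 2 * ln n%:R :> R by field.
  by rewrite expRD -expr2 sqrtr_sqr ger0_norm ?expR_ge0 //; congr expR; field.
by rewrite [(_ + _) * ln _]mulrDl !expRD; ring.
Qed.

Lemma stirling_ratio_gt0 n : (0 < n)%N -> 0 < stirling_ratio R n.
Proof.
by move=> n0; rewrite stirling_ratioE // divr_gt0 ?stirling_scale_gt0 // ltr0n fact_gt0.
Qed.

Lemma stirling_ratio_sqr n : (0 < n)%N -> stirling_ratio R n ^+ 2 =
  n`!%:R ^+ 2 / ((n%:R ^+ n * expR (- n%:R)) ^+ 2 * (2 * pi * n%:R)).
Proof.
move=> n0; rewrite /stirling_ratio expr_div_n [X in _ / X = _]exprMn.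
by rewrite sqr_sqrtr // !mulr_ge0 ?pi_ge0.
Qed.

(** Powers of n and exponentials cancel in r(2n)/r(n)^2, leaving a central binomial coefficient,
    hence W_(2n); squaring removes the square roots. *)
Lemma stirling_ratio_double n : (0 < n)%N ->
  stirling_ratio R (2 * n) ^+ 2 / stirling_ratio R n ^+ 4 =
  4 * n%:R / pi * wallis R (2 * n) ^+ 2.
Proof.
move=> n0; rewrite wallis_even -[4%N]/(2 * 2)%N exprM !stirling_ratio_sqr ?muln_gt0 //.
have pi0 : pi != 0 :> R by rewrite gt_eqF ?pi_gt0.
have n0' : n%:R != 0 :> R by rewrite pnatr_eq0 -lt0n.
have h1 : n`!%:R != 0 :> R by rewrite pnatr_eq0 -lt0n fact_gt0.
have h3 : 2 ^+ n != 0 :> R by rewrite expf_neq0 // pnatr_eq0.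
have -> : 4 ^+ n = 2 ^+ n * 2 ^+ n :> R by rewrite -exprMn; congr (_ ^+ _); ring.
have -> : expR (- (2 * n)%:R) = expR (- n%:R) ^+ 2 :> R.
  by rewrite natrM expr2 -expRD; congr expR; ring.
have -> : (2 * n)%:R ^+ (2 * n) = (2 ^+ n * n%:R ^+ n) ^+ 2 :> R.
  by rewrite mulnC exprM natrM exprMn [n%:R ^+ n * _]mulrC.
rewrite natrM.
have h4 : n%:R ^+ n != 0 :> R by rewrite expf_neq0.
have h5 : expR (- n%:R) != 0 :> R by rewrite gt_eqF ?expR_gt0.
move: pi n%:R n`!%:R (2 ^+ n) (n%:R ^+ n) (expR (- n%:R)) (2 * n)`!%:R n0' h1 h3 h4 h5 pi0.
move=> p f a b c d e *; field; do ?[apply/andP; split=> //].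
Qed.

(** W_(2n)^2 lies between W_(2n) W_(2n+1) and W_(2n-1) W_(2n), both given by [wallis_mulS]. *)
Lemma wallis_even_bounds n : (0 < n)%N ->
  (2 * n%:R) / (2 * n%:R + 1) <= 4 * n%:R / pi * wallis R (2 * n) ^+ 2 <= 1.
Proof.
move=> n0; have pi0 := pi_gt0 R; have n0' : 0 < n%:R :> R by rewrite ltr0n.
have := wallis_mulS R (2 * n); have := wallis_mulS R (2 * n).-1.
have := wallis_decr R (2 * n); have := wallis_decr R (2 * n).-1.
rewrite prednK ?muln_gt0 // -[(2 * n).+1%:R]natr1 natrM.
move: (wallis _ _) (wallis _ _) (wallis _ _) => u v w.
move=> /andP[w0 wv] /andP[u0 uw] vwE wuE.
rewrite [_ / pi * _]mulrAC.
have wvw : w ^+ 2 <= v * w by rewrite expr2 ler_wpM2r.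
have wwu : w * u <= w ^+ 2 by rewrite expr2 ler_wpM2l.
apply/andP; split; last by rewrite ler_pdivrMr //; nra.
by rewrite ler_pdivlMr // mulrAC ler_pdivrMr; nra.
Qed.

(* The trapezoid rule overestimates the integral of the convex function 1/t over [1, y]. *)
Lemma ln_trapezoid (y : R) : 1 <= y -> ln y <= 2^-1 * (y - y^-1).
Proof.
move=> y1.
have df (t : R) : 1 <= t <= y ->
    is_derive t 1 (2^-1 \*: (id - GRing.inv) - @ln R) (2^-1 * (1 - t^-1) ^+ 2).
  move=> /andP[t1 _].
  have t0 : 0 < t by lra.
  have dV : is_derive t 1 GRing.inv (- t ^- 2 *: 1).
    apply: is_deriveV; by rewrite gt_eqF.
  have dl := is_derive1_ln t0.
  apply: is_derive_eq.
  rewrite /GRing.scale /= expr2 invfM.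
  by move: (t^-1) => u; field.
have [c _] := MVT_cc y1 df.
rewrite !fctE /= invr1 ln1 subrr /GRing.scale /= mulr0 !subr0 => E.
by rewrite -subr_ge0 E mulr_ge0 ?subr_ge0 // mulr_ge0 ?invr_ge0 // sqr_ge0.
Qed.

Lemma stirling_ratioS n : (0 < n)%N -> stirling_ratio R n.+1 =
  stirling_ratio R n * expR (1 - (n%:R + 1 / 2) * ln (1 + n%:R^-1)).
Proof.
move=> n0; have n0' : 0 < n%:R :> R by rewrite ltr0n.
have -> : 1 + n%:R^-1 = n.+1%:R / n%:R :> R.
  by rewrite -natr1 mulrDl divff ?gt_eqF // div1r.
rewrite ln_div ?posrE ?ltr0n // !stirling_ratioE // /stirling_scale.
rewrite factS natrM -[X in X * _ / _ = _](@lnK _ n.+1%:R) ?posrE ?ltr0n //.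
rewrite !invfM -!expRN.
set s := (Num.sqrt _)^-1.
rewrite -[RHS]mulrA -[s * _ * _]mulrA -expRD [LHS]mulrC -!mulrA [expR (ln _) * _]mulrC.
move: (ln n.+1%:R) (ln n%:R) => a b.
have -> : - ((n%:R + 1 / 2) * b - n%:R) + (1 - (n%:R + 1 / 2) * (a - b)) =
    - ((n.+1%:R + 1 / 2) * a - n.+1%:R) + a by rewrite -natr1; ring.
by rewrite expRD; ring.
Qed.

(** [ln_trapezoid] at y = 1 + 1/n gives r(n+1)/r(n) >= exp(-1/(4n(n+1))), and 1/(n(n+1)) telescopes.
    This positive bound excludes the limit 0 and later allows division by r. *)
Lemma stirling_ratio_ge n : (0 < n)%N ->
  stirling_ratio R 1 * expR (- (1 / 4)) <= stirling_ratio R n.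
Proof.
case: n => // n _.
suff : stirling_ratio R 1 * expR ((4 * n.+1%:R)^-1 - 1 / 4) <= stirling_ratio R n.+1.
  apply: le_trans; rewrite ler_pM2l ?stirling_ratio_gt0 // ler_expR lerDr.
  by rewrite invr_ge0 mulr_ge0.
elim: n => [|n IH].
  by rewrite (_ : _ - _ = 0) ?expR0 ?mulr1 //; field.
rewrite (stirling_ratioS (ltn0Sn n)).
set x : R := n.+1%:R in IH *.
have x0 : 0 < x by rewrite ltr0n.
have -> : (4 * n.+2%:R)^-1 - 1 / 4 =
    ((4 * x)^-1 - 1 / 4) + (1 - (1 + (4 * x * (x + 1))^-1)) :> R.
  by rewrite -[n.+2%:R]natr1 -/x; field; apply/andP; split; lra.
rewrite expRD mulrA; apply: ler_pM => //; last 1 first.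
  rewrite ler_expR lerD2l lerN2.
  have x1 : 1 <= 1 + x^-1 by rewrite lerDl invr_ge0 ltW.
  apply: le_trans (ler_wpM2l _ (ln_trapezoid x1)) _; first by lra.
  by rewrite le_eqVlt; apply/orP; left; apply/eqP; field; do ?[apply/andP; split]; lra.
by rewrite mulr_ge0 ?expR_ge0 // ltW // stirling_ratio_gt0.
Qed.

End StirlingRatio.

(** * The limit of the Stirling ratio *)

Lemma cvg_le_inv (R : realType) (u : nat -> R) (l C : R) :
  (\forall n \near \oo, `|u n - l| <= C / n%:R) -> (u @ \oo --> l).
Proof.
move=> uC; apply/cvgrPdist_le => e e0.
near=> n; rewrite distrC.
have n0 : 0 < n%:R :> R by rewrite ltr0n; near: n; exact: nbhs_infty_gt.
have ne : C / e <= n%:R by near: n; exact: nbhs_infty_ger.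
apply: le_trans (_ : C / n%:R <= _); first by near: n.
by rewrite ler_pdivrMr // mulrC -ler_pdivrMr.
Unshelve. all: by end_near. Qed.

Lemma cvg_double (R : realType) (u : nat -> R) (l : R) :
  (u @ \oo --> l) -> ((fun n => u (2 * n)%N) @ \oo --> l).
Proof.
move=> ul; apply: (@cvg_comp _ _ _ (fun n => 2 * n)%N u) ul.
by apply/cvgnyPge => A; near=> n; apply: leq_trans (_ : n <= _)%N;
  [near: n; exact: nbhs_infty_ge | rewrite leq_pmull].
Unshelve. all: by end_near. Qed.

(** r(2n)^2/r(n)^4 tends to l^2/l^4, and to 1 by Wallis; l > 0 then forces l = 1. *)
Lemma stirling_ratio_lim (R : realType) (l : R) :
  stirling_ratio R @ \oo --> l -> l = 1.
Proof.
move=> rl.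
have l0 : 0 < l.
  apply: lt_le_trans (_ : stirling_ratio R 1 * expR (- (1 / 4)) <= _).
    by rewrite mulr_gt0 ?expR_gt0 ?stirling_ratio_gt0.
  apply: (cvgr_to_ge rl); near=> n; apply: stirling_ratio_ge.
  by near: n; exact: nbhs_infty_gt.
set q : nat -> R := fun n => stirling_ratio R (2 * n) ^+ 2 / stirling_ratio R n ^+ 4.
have q1 : (q @ \oo --> (1 : R)).
  apply: (@cvg_le_inv _ _ _ 1); near=> n.
  have n0 : (0 < n)%N by near: n; exact: nbhs_infty_gt.
  have n0' : 0 < n%:R :> R by rewrite ltr0n.
  have := wallis_even_bounds R n0; rewrite /q stirling_ratio_double //.
  move: (_ * wallis _ _ ^+ 2) => w /andP[w1 w2].
  rewrite ler_norml; apply/andP; split; last by have : 0 <= 1 / n%:R :> R; [exact: divr_ge0 | lra].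
  have u0 : 0 <= 1 / n%:R :> R by exact: divr_ge0.
  have nu : n%:R * (1 / n%:R) = 1 :> R by rewrite mulrCA divff ?mulr1 ?gt_eqF.
  have : 1 - 1 / n%:R <= (2 * n%:R) / (2 * n%:R + 1) :> R.
    rewrite ler_pdivlMr; last by lra.
    by move: n%:R (1 / n%:R) u0 n0' nu => v u u0 v0 uv; nra.
  by move: (_ / _) w1 => v w1 v1; lra.
have rX m : (fun n => stirling_ratio R n ^+ m) @ \oo --> l ^+ m.
  elim: m => [|m IH]; first by rewrite expr0; under eq_cvg do rewrite expr0; exact: cvg_cst.
  by rewrite exprS; under eq_cvg do rewrite exprS; exact: cvgM.
have ql : q @ \oo --> l ^+ 2 / l ^+ 4.
  apply: cvgM; first exact: (@cvg_double _ (fun n => stirling_ratio R n ^+ 2)).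
  by apply: cvgV (rX 4%N); rewrite expf_neq0 // gt_eqF.
have l1 : l ^+ 2 / l ^+ 4 = 1 by exact: norm_cvg_unique ql q1.
have l4 : l ^+ 4 != 0 by rewrite expf_neq0 // gt_eqF.
have l24 : l ^+ 2 = l ^+ 4.
  by have := congr1 (fun x => x * l ^+ 4) l1; rewrite /= divfK // mul1r.
have : l ^+ 2 * (l ^+ 2 - 1) = 0 by rewrite mulrBr mulr1 -exprD -l24 subrr.
move/eqP; rewrite mulf_eq0 expf_eq0 /= gt_eqF //= subr_eq0 => /eqP l21.
by apply/eqP; rewrite -(@eqrXn2 _ 2) ?expr1n ?l21 // ltW.
Unshelve. all: by end_near. Qed.

(** * Comparison of the expansions *)

Lemma horner_le_sum (R : realType) (p : {poly R}) (s : R) : 0 <= s <= 1 ->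
  `|p.[s]| <= \sum_(i < size p) `|p`_i|.
Proof.
move=> /andP[s0 s1]; rewrite horner_coef; apply: le_trans (ler_norm_sum _ _ _) _.
apply: ler_sum => i _; rewrite normrM ler_piMr // ger0_norm ?exprn_ge0 //.
exact: exprn_ile1.
Qed.

Section Drift.
Variables (R : realType) (N : nat) (p : nat -> {poly R}).
Hypothesis p0 : p 0 = 1.
Hypothesis dp : forall k, (k < N)%N ->
  (p k.+1)^`() = ('X - (k%:R + 1 / 2)%:P) * p k.
Hypothesis p1 : forall k, (k <= N)%N -> (p k).[1] = (p k).[0].

(** The truncated expansion at n = x + u and s = 1 - u. *)
Let K (x : R) M : R -> R :=
  fun u => \sum_(k < M.+1) (p k).[1 - u] * (x + u)^-1 ^+ k.

(** Induction on M: by [dp], differentiating p_(M+1) cancels the previous remainder, and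
    differentiating the power of [x + u] creates the next one. *)
Lemma is_derive_moment_sum (x u : R) M : (M <= N)%N -> 0 < x + u ->
  is_derive u 1 (K x M)
    ((u - 1 / 2) * (x + u)^-1 * K x M u
     + (p M).[1 - u] * (1 / 2 - u - M%:R) * (x + u)^-1 ^+ M.+1).
Proof.
move=> + xu; have xu0 : x + u != 0 by rewrite gt_eqF.
have dV : is_derive u 1 (fun u => (x + u)^-1) (- (x + u)^-1 ^+ 2).
  have -> : - (x + u)^-1 ^+ 2 = - (x + u) ^- 2 *: (0 + 1).
    by rewrite add0r /GRing.scale /= mulr1 exprVn.
  by apply: is_deriveV.
have dX m : is_derive u 1 (fun u => (x + u)^-1 ^+ m) (- m%:R * (x + u)^-1 ^+ m.+1).
  have := is_deriveX m dV.
  have -> : (m%:R * (x + u)^-1 ^+ m.-1) *: - (x + u)^-1 ^+ 2 = - m%:R * (x + u)^-1 ^+ m.+1.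
    rewrite /GRing.scale /=; case: m => [|m] /=; first by ring.
    by rewrite ![_ ^+ _.+1]exprS; ring.
  by rewrite fctE.
have dP k : is_derive u 1 (fun u => (p k).[1 - u]) (- (p k)^`().[1 - u]).
  have dl : is_derive u 1 (fun u : R => 1 - u) (-1).
    by apply: is_derive_eq; rewrite add0r mul1r.
  have := @is_derive1_comp _ (horner (p k)) (fun v => 1 - v) u _ _
    (is_derive_poly (p k) (1 - u)) dl.
  by rewrite mulrN1.
elim: M => [_|M IH ltMN].
  have -> : K x 0 = cst 1.
    by apply/funext => v; rewrite /K big_ord1 p0 hornerC expr0 mulr1.
  rewrite p0 hornerC /= (_ : _ + _ = 0); first exact: is_derive_cst.
  by rewrite expr1; ring.
have -> : K x M.+1 = K x M + (fun u => (p M.+1).[1 - u]) * (fun u => (x + u)^-1 ^+ M.+1).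
  by apply/funext => v; rewrite /K big_ord_recr.
have {}IH := IH (ltnW ltMN).
have dl := dX M.+1; have dr := dP M.+1.
apply: (@is_derive_eq _ _ _ _ _ _ _ _ (is_deriveD IH (is_deriveM dr dl))).
rewrite dp // hornerM hornerXsubC !fctE ![_ ^+ M.+2]exprS -![M.+1%:R]natr1.
move: (K x M u) ((x + u)^-1) (_ ^+ M.+1) (_).[_] (_).[_] => a b c d e.
by rewrite /GRing.scale /=; field.
Qed.

(* Follows the line of constant [x + s], with [s = 1 - u], from [(x, 1)] to
   [(x + 1, 0)]; the exact expansion would make it constant. *)
Let F (x u : R) := expR ((x + 1 / 2) * ln (x + u) - (x + u)) * K x N u.

(** The exponential is an integrating factor: its logarithmic derivative (1/2 - u)/(x + u) cancels
    the term proportional to [K]. *)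
Lemma is_derive_drift (x u : R) : 0 < x + u ->
  is_derive u 1 (F x)
    (expR ((x + 1 / 2) * ln (x + u) - (x + u)) *
     ((p N).[1 - u] * (1 / 2 - u - N%:R) * (x + u)^-1 ^+ N.+1)).
Proof.
move=> xu; have dK := is_derive_moment_sum (leqnn N) xu.
have dD : is_derive u 1 (fun v : R => x + v) 1.
  by apply: is_derive_eq; rewrite add0r mul1r.
have dl : is_derive u 1 (fun v => ln (x + v)) (x + u)^-1.
  have := @is_derive1_comp _ (@ln R) (fun v => x + v) u _ _ (is_derive1_ln xu) dD.
  by rewrite mulr1.
have dE : is_derive u 1 (fun v => (x + 1 / 2) * ln (x + v) - (x + v))
    ((x + 1 / 2) * (x + u)^-1 - 1).
  exact: (is_deriveB (is_deriveZ (x + 1 / 2) dl) dD).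
have dF := is_deriveM (@is_derive1_comp _ (@expR R) _ u _ _ (is_derive_expR _) dE) dK.
apply: (@is_derive_eq _ _ _ _ _ _ _ _ dF).
rewrite /GRing.scale /=.
move: (K x N u) (_ ^+ N.+1) (_).[_] (expR _) => a b c d.
have xu0 : x + u != 0 by rewrite gt_eqF.
by field.
Qed.

Let B (x : R) : R := \sum_(k < N.+1) (p k).[0] / x ^+ k.

(** Here s = 1; [p1] replaces it by s = 0, so that both ends involve the same [B]. *)
Lemma drift0 (x : R) : F x 0 = expR ((x + 1 / 2) * ln x - x) * B x.
Proof.
rewrite /F /K addr0; congr (_ * _); apply: eq_bigr => k _.
by rewrite subr0 p1 ?exprVn // -ltnS.
Qed.

Lemma drift1 (x : R) :
  F x 1 = expR ((x + 1 / 2) * ln (x + 1) - (x + 1)) * B (x + 1).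
Proof.
by rewrite /F /K subrr; congr (_ * _); apply: eq_bigr => k _; rewrite exprVn.
Qed.

Lemma drift_bound : exists C, forall x : R, 1 <= x ->
  `|F x 1 - F x 0| <= C / x ^+ N.+1 * expR ((x + 1 / 2) * ln x - x).
Proof.
pose q := p N * ('X - (1 / 2 + N%:R)%:P).
pose C := expR (1 / 2) * \sum_(i < size q) `|q`_i|.
exists C => x x1; have x0 : 0 < x by lra.
have xu (u : R) : 0 <= u <= 1 -> 0 < x + u by move=> /andP[u0 _]; lra.
have [c /andP[c0 c1] ->] := MVT_cc ler01 (fun u hu => is_derive_drift (xu u hu)).
have xc : 0 < x + c by lra.
have -> : (p N).[1 - c] * (1 / 2 - c - N%:R) = q.[1 - c].
  by rewrite hornerM hornerXsubC; congr (_ * _); field.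
rewrite subr0 mulr1 !normrM ger0_norm ?expR_ge0 // normrX.
rewrite [`|(x + c)^-1|]ger0_norm; last by rewrite invr_ge0 ltW.
have -> : C / x ^+ N.+1 * expR ((x + 1 / 2) * ln x - x) =
    expR (1 / 2 + ((x + 1 / 2) * ln x - x)) * ((\sum_(i < size q) `|q`_i|) * x^-1 ^+ N.+1).
  by rewrite [expR (1 / 2 + _)]expRD /C exprVn; ring.
have xci : (x + c)^-1 ^+ N.+1 <= x^-1 ^+ N.+1.
  apply: lerXn2r; rewrite ?nnegrE ?invr_ge0; [exact: ltW..|].
  by rewrite lef_pV2 ?posrE //; lra.
have qle : `|q.[1 - c]| <= \sum_(i < size q) `|q`_i|.
  by apply: horner_le_sum; apply/andP; split; lra.
have xc0 : 0 <= (x + c)^-1 ^+ N.+1 by rewrite exprn_ge0 // invr_ge0 ltW.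
apply: ler_pM; [exact: expR_ge0|exact: mulr_ge0| |exact: ler_pM].
(* By ln(1+y) <= y with y = c/x, (x + 1/2) ln(1 + c/x) <= c + c/(2x) <= c + 1/2; this is the source
   of [expR (1 / 2)] in [C]. *)
rewrite ler_expR.
have -> : x + c = x * (1 + x^-1 * c) by rewrite mulrDr mulr1 mulVKf ?gt_eqF.
have xi : 0 < x^-1 by rewrite invr_gt0.
have xix : x * x^-1 = 1 by rewrite divff ?gt_eqF.
have y0 : 0 <= x^-1 * c by rewrite mulr_ge0 // ltW.
have y1 : x^-1 * c <= 1.
  by apply: mulr_ile1 => //; [exact: ltW | rewrite invf_le1].
rewrite lnM ?posrE //; last by lra.
have := @le_ln1Dx R (x^-1 * c) ltac:(lra).
have -> : x * (1 + x^-1 * c) = x + c by rewrite mulrDr mulr1 mulrA xix mul1r.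
have : x * (x^-1 * c) = c by rewrite mulrA xix mul1r.
move: (ln x) (x^-1 * c) (ln (1 + x^-1 * c)) y0 y1 => L y l y0 y1 xy ly.
have : (x + 1 / 2) * l <= (x + 1 / 2) * y.
  by apply: ler_wpM2l => //; apply: addr_ge0; [exact: ltW | exact: divr_ge0].
have -> : (x + 1 / 2) * y = c + 1 / 2 * y by rewrite mulrDl xy.
rewrite mulrDr; lra.
Qed.

End Drift.

(** [drift_bound] multiplied by sqrt(2 pi)/n!; the factor 1/r(n) that appears is bounded through
    [stirling_ratio_ge]. *)
Lemma stirling_ratio_expansion_drift (R : realType) N (p : nat -> {poly R}) :
  p 0 = 1 ->
  (forall k, (k < N)%N -> (p k.+1)^`() = ('X - (k%:R + 1 / 2)%:P) * p k) ->
  (forall k, (k <= N)%N -> (p k).[1] = (p k).[0]) ->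
  let rho n := (\sum_(k < N.+1) (p k).[0] / n%:R ^+ k) / stirling_ratio R n in
  exists C, forall n, (0 < n)%N -> `|rho n.+1 - rho n| <= C / n%:R ^+ N.+1.
Proof.
move=> p0 dp p1 rho.
have [C CP] := drift_bound p0 dp.
pose c := stirling_ratio R 1 * expR (- (1 / 4)).
have c0 : 0 < c by rewrite mulr_gt0 ?expR_gt0 ?stirling_ratio_gt0.
exists (C / c) => n n0.
have n1 : 1 <= n%:R :> R by rewrite ler1n.
have n0' : 0 < n%:R :> R by lra.
have := CP _ n1; rewrite drift0 // drift1 //.
set E0 := expR (_ * ln n%:R - _); set E1 := expR (_ * ln (n%:R + 1) - _).
(* The exponent in [E1] is one ln(n+1) short; the resulting factor n+1 cancels against (n+1)!/n!. *)
have scaleS : stirling_scale R n.+1 = Num.sqrt (2 * pi) * (E1 * n.+1%:R).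
  rewrite /stirling_scale /E1 natr1; congr (_ * _).
  rewrite -[X in _ = _ * X](@lnK R n.+1%:R) ?posrE ?ltr0n // -expRD.
  by congr expR; move: (ln _) => l; rewrite -natr1; ring.
have rhoE : rho n.+1 - rho n = Num.sqrt (2 * pi) / n`!%:R *
    (E1 * (\sum_(k < N.+1) (p k).[0] / (n%:R + 1) ^+ k)
      - E0 * (\sum_(k < N.+1) (p k).[0] / n%:R ^+ k)).
  rewrite /rho !stirling_ratioE // scaleS /stirling_scale -/E0 natr1 factS natrM.
  move: (\sum_(_ < _) _) (\sum_(_ < _) _) => u v.
  have nf0 : n`!%:R != 0 :> R by rewrite pnatr_eq0 -lt0n fact_gt0.
  have ns0 : n.+1%:R != 0 :> R by rewrite pnatr_eq0.
  rewrite !invf_div.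
  by move: n.+1%:R n`!%:R nf0 ns0 => a b a0 b0; field; rewrite a0 b0.
move=> CE.
have E0gt0 : 0 < E0 by exact: expR_gt0.
have C0 : 0 <= C / n%:R ^+ N.+1.
  by rewrite -(pmulr_lge0 _ E0gt0); exact: le_trans (normr_ge0 _) CE.
have s0 : 0 <= Num.sqrt (2 * pi) / n`!%:R :> R by rewrite divr_ge0 // sqrtr_ge0.
rewrite rhoE normrM ger0_norm //; apply: le_trans (ler_wpM2l s0 CE) _.
have -> : Num.sqrt (2 * pi) / n`!%:R * (C / n%:R ^+ N.+1 * E0) =
    C / n%:R ^+ N.+1 * (stirling_ratio R n)^-1.
  by rewrite stirling_ratioE // invf_div /stirling_scale -/E0; ring.
rewrite [C / c / _]mulrAC ler_wpM2l // lef_pV2 ?posrE ?stirling_ratio_gt0 //.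
exact: stirling_ratio_ge.
Qed.

(** * Identification of the coefficients *)

Lemma expansion_bound (R : realType) (a : nat -> R) : stirling_coefficients a ->
  forall N, exists2 C, 0 < C & \forall n \near \oo,
    `|stirling_ratio R n - \sum_(k < N.+1) a k / n%:R ^+ k| <= C / n%:R ^+ N.+1.
Proof.
move=> ha N; have /eqO_exP [C C0 near_n] := ha N.
exists C => //; near=> n.
have : `|stirling_ratio R n - \sum_(k < N.+1) a k / n%:R ^+ k| <= C * `|(n%:R ^+ N.+1)^-1|.
  by near: n.
by rewrite [`|_^-1|]ger0_norm // invr_ge0 exprn_ge0.
Unshelve. all: by end_near. Qed.

Lemma stirling_ratio_cvg (R : realType) (a : nat -> R) :
  stirling_coefficients a -> stirling_ratio R @ \oo --> a 0%N.
Proof.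
move=> ha; have [C C0 near_n] := expansion_bound ha 0.
apply: (@cvg_le_inv _ _ _ C); near=> n.
have : `|stirling_ratio R n - \sum_(k < 1) a k / n%:R ^+ k| <= C / n%:R ^+ 1 by near: n.
by rewrite big_ord1 expr0 divr1 expr1.
Unshelve. all: by end_near. Qed.

Lemma increments_double (R : realType) (u : nat -> R) C m :
  (forall n, (0 < n)%N -> `|u n.+1 - u n| <= C / n%:R ^+ m) ->
  forall n, (0 < n)%N -> `|u (2 * n)%N - u n| <= n%:R * (C / n%:R ^+ m).
Proof.
move=> uC n n0; have n0' : 0 < n%:R :> R by rewrite ltr0n.
have C0 : 0 <= C by have := uC 1%N isT; rewrite expr1n divr1; exact: le_trans.
rewrite -telescope_sumr ?leq_pmull // big_nat.
apply: le_trans (ler_norm_sum _ _ _) _.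
apply: (@le_trans _ _ (\sum_(n <= i < 2 * n | (n <= i < 2 * n)%N) (C / n%:R ^+ m))).
  apply: ler_sum => i /andP[ni _]; have i0 : (0 < i)%N by exact: leq_trans ni.
  apply: le_trans (uC i i0) _; rewrite ler_wpM2l //.
  rewrite lef_pV2 ?posrE ?exprn_gt0 ?ltr0n //.
  by apply: lerXn2r; rewrite ?nnegrE ?ler_nat.
by rewrite -big_nat big_const_nat mul2n -addnn addnK iter_addr addr0 mulr_natl.
Qed.

Lemma stirling_coefficientE (R : realType) (a : nat -> R) :
  stirling_coefficients a -> forall k, a k = stirling_formula R k.
Proof.
move=> ha; have a0 := stirling_ratio_lim (stirling_ratio_cvg ha).
elim/ltn_ind => -[_|k IH].
  have [p [p0 _ _ pE]] := moment_system R 0.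
  by rewrite -pE // p0 hornerC a0.
(* Order K+1 makes the increments of B/r O(n^(-K-2)); summing n of them and multiplying by n^K still
   leaves O(1/n). *)
pose K := k.+1; have [p [p0 dp p1 pE]] := moment_system R K.+1.
have [C CP] := stirling_ratio_expansion_drift p0 dp p1.
have [D D0 near_n] := expansion_bound ha K.
set r := stirling_ratio R in near_n *.
have rcvg : r @ \oo --> (1 : R) by rewrite -a0; exact: stirling_ratio_cvg.
set B : nat -> R := fun n => \sum_(k < K.+2) (p k).[0] / n%:R ^+ k.
pose d := (p K).[0] - a K.
have defect : (fun n => n%:R ^+ K * (B n - r n)) @ \oo --> d.
  (* By induction the terms below K cancel. What remains beyond d is the last term of [B] and the
     error of the given expansion. *)
  apply: (@cvg_le_inv _ _ _ (`|(p K.+1).[0]| + D)); near=> n.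
  have n0 : 0 < n%:R :> R by rewrite ltr0n; near: n; exact: nbhs_infty_gt.
  have nK0 : n%:R ^+ K != 0 :> R by rewrite expf_neq0 // gt_eqF.
  have -> : n%:R ^+ K * (B n - r n) - d = (p K.+1).[0] / n%:R
      - n%:R ^+ K * (r n - \sum_(k < K.+1) a k / n%:R ^+ k).
    rewrite /B big_ord_recr big_ord_recr [in RHS]big_ord_recr /= exprSr -/K.
    rewrite (eq_bigr (fun i : 'I_K => a i / n%:R ^+ i)); last first.
      by move=> i _; rewrite IH // pE //; have := ltn_ord i; rewrite /K; lia.
    move: (\sum_(_ < _) _) (r n) => s t; rewrite /d.
    by move: (n%:R ^+ K) nK0 => x x0; field; rewrite x0 gt_eqF.
  rewrite (le_trans (ler_normB _ _)) // [leRHS]mulrDl lerD //.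
    by rewrite normrM [`|_^-1|]ger0_norm // invr_ge0 ltW.
  have nKge0 : 0 <= n%:R ^+ K :> R by exact: exprn_ge0.
  rewrite normrM [`|n%:R ^+ K|]ger0_norm //.
  apply: le_trans (_ : n%:R ^+ K * (D / n%:R ^+ K.+1) <= _).
    by rewrite ler_wpM2l //; near: n.
  by rewrite exprSr invfM mulrCA mulVKf.
pose w n := n%:R ^+ K * (B n / r n - 1).
have wcvg : w @ \oo --> d.
  have -> : d = d * 1^-1 by rewrite invr1 mulr1.
  apply: cvg_trans (cvgM defect (cvgV (oner_neq0 _) rcvg)).
  apply: near_eq_cvg; near=> n.
  have r0 : r n != 0.
    by rewrite gt_eqF ?stirling_ratio_gt0 //; near: n; exact: nbhs_infty_gt.
  by rewrite /w /=; field.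
have w2 := cvg_double wcvg.
have wd : (fun n => w (2 * n)%N - 2 ^+ K * w n) @ \oo --> d - 2 ^+ K * d.
  by apply: cvgB w2 _; apply: cvgM wcvg; exact: cvg_cst.
have w0 : (fun n => w (2 * n)%N - 2 ^+ K * w n) @ \oo --> (0 : R).
  (* The constants -1 in [w] cancel, leaving (2n)^K times the change of B/r from n to 2n. *)
  apply: (@cvg_le_inv _ _ _ (2 ^+ K * C)); near=> n.
  have n0 : (0 < n)%N by near: n; exact: nbhs_infty_gt.
  have n0' : 0 < n%:R :> R by rewrite ltr0n.
  have -> : w (2 * n)%N - 2 ^+ K * w n - 0 =
      2 ^+ K * n%:R ^+ K * (B (2 * n)%N / r (2 * n)%N - B n / r n).
    by rewrite /w natrM exprMn subr0; ring.
  rewrite normrM ger0_norm ?mulr_ge0 ?exprn_ge0 //.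
  apply: (@le_trans _ _ (2 ^+ K * n%:R ^+ K * (n%:R * (C / n%:R ^+ K.+2)))).
    rewrite ler_wpM2l ?mulr_ge0 ?exprn_ge0 //.
    exact: (@increments_double R (fun n => B n / r n) C K.+2).
  rewrite !exprSr.
  rewrite le_eqVlt; apply/orP; left; apply/eqP.
  by field; rewrite !gt_eqF ?exprn_gt0.
have : d - 2 ^+ K * d = 0 by exact: norm_cvg_unique wd w0.
rewrite -[X in X - _]mul1r -mulrBl => /eqP; rewrite mulf_eq0 subr_eq0.
(* As K >= 1, d = 2^K d forces d = 0; K = 0 would give nothing, hence the separate base case. *)
have -> : 1 == 2 ^+ K :> R = false.
  by rewrite lt_eqF // exprn_egt1 // ltr1n.
by rewrite /d subr_eq0 /= => /eqP <-; exact: pE.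
Unshelve. all: by end_near. Qed.

Theorem corollary2p1 (R : realType) (a : nat -> R)
    (ha : stirling_coefficients a) (k : nat) :
  a k = ((2 * k)`!)%:R / (2 ^+ k * (k`!)%:R) *
    \sum_(i < (2 * k).+1)
      gbinom (k%:R + i%:R - 1 / 2) i * gbinom (3 * k%:R + 1 / 2) (2 * k - i)
        * 2 ^+ i *
      \sum_(j < i.+1)
        'C(i, j)%:R * ((-1) ^+ j / ((2 * k + i + j)`!)%:R) *
        \sum_(l < j.+1)
          (-1) ^+ l * 'C(j, l)%:R * (j%:R - l%:R) ^+ (2 * k + i + j).
Proof. exact: stirling_coefficientE. Qed.
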